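(* Let $\kappa$ be a regular uncountable cardinal and suppose that $\chi(\kappa)>1$. Then $\chi(\kappa)=\max(\mathrm{spec}(\kappa))$.
   Context: A $C$-sequence over $\kappa$ is $\vec C=\langle C_\beta\mid\beta<\kappa\rangle$ with each $C_\beta$ a closed subset of $\beta$ with $\sup(C_\beta)=\sup(\beta)$. For such $\vec C$, $\chi(\vec C)$ is the least cardinal $\chi\le\kappa$ such that there exist $\Delta\in[\kappa]^\kappa$ and $b:\kappa\to[\kappa]^\chi$ with $\Delta\cap\alpha\subseteq\bigcup_{\beta\in b(\alpha)}C_\beta$ for every $\alpha<\kappa$. $\chi(\kappa)$ is $0$ if $\kappa$ is weakly compact, and otherwise the least cardinal $\chi\le\kappa$ such that $\chi(\vec C)\le\chi$ for every $C$-sequence $\vec C$ over $\kappa$ (i.e., every $C$-sequence admits such $\Delta$ and $b:\kappa\to[\kappa]^\chi$). $\mathrm{spec}(\kappa)=\{\chi(\vec C)\mid\vec C\text{ a }C\text{-sequence over }\kappa\}\setminus\omega$. *)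

(* Defs.v *)
From mathcomp Require Import all_boot all_order.
From mathcomp Require Import all_classical.
From mathcomp Require Import wochoice.

Set Implicit Arguments.
Unset Strict Implicit.
Unset Printing Implicit Defensive.

Import Order.TTheory.
Local Open Scope classical_set_scope.
Local Open Scope card_scope.
Local Open Scope order_scope.

(* The cardinal kappa is a well-ordered type K, its elements being the ordinals
   below kappa.  As in von Neumann's encoding, an ordinal at most kappa is the
   set of its predecessors, i.e. an initial segment of K; in particular kappa
   itself is [set: K], the order on these ordinals is inclusion, and the least
   element of a nonempty family of them is its intersection. *)

Definition card_lt (T U : Type) (A : set T) (B : set U) : Prop :=
  ~ (B #<= A).

Section Ordinals.
Context {d : Order.disp_t} {K : orderType d}.
Implicit Types (A : set K) (S : set (set K)).

Definition below (a : K) : set K := [set x | x < a].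

Definition is_ordinal A : Prop := forall a, A a -> below a `<=` A.

Definition is_cardinal A : Prop :=
  is_ordinal A /\ forall a, A a -> card_lt (below a) A.

(* Junk value [set: K] on the empty family. *)
Definition least S : set K := \bigcap_(A in S) A.

Definition is_max S A : Prop := S A /\ forall B, S B -> B `<=` A.

Definition cofinal A : Prop := forall a, exists2 x, A x & a <= x.

End Ordinals.

Definition regular_uncountable_cardinal d (K : orderType d) : Prop :=
  [/\ well_order (<=%O : rel K),
      is_cardinal [set: K],
      ~ countable [set: K] &
      forall A : set K, cofinal A -> ~ card_lt A [set: K]].

(* kappa is uncountable and kappa --> (kappa)^2_2; a colouring of the
   two-element subsets of kappa is read off the pairs a < b. *)
Definition weakly_compact d (K : orderType d) : Prop :=
  ~ countable [set: K] /\
  forall c : K -> K -> bool, exists (H : set K) (i : bool),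
    H #= [set: K] /\ forall a b, H a -> H b -> a < b -> c a b = i.

Section CSequences.
Context {d : Order.disp_t} {K : orderType d}.

(* Every a < b with 0 < a and sup (D `&` a) = a belongs to D. *)
Definition closed_in (b : K) (D : set K) : Prop :=
  forall a, a < b -> below a !=set0 -> supremums (D `&` below a) a -> D a.

(* A subset of b has a unique supremum in K when K is well-ordered, so the
   last clause is sup (C b) = sup b; for b = a + 1 it says sup (C b) = a. *)
Definition C_sequence (C : K -> set K) : Prop :=
  forall b, [/\ C b `<=` below b,
                closed_in b (C b) &
                supremums (C b) = supremums (below b)].

Definition covered_by (C : K -> set K) (X : set K) : Prop :=
  exists (Delta : set K) (b : K -> set K),
    [/\ Delta #= [set: K],
        forall a, b a #= X &
        forall a, Delta `&` below a `<=` \bigcup_(x in b a) C x].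

Definition chi (C : K -> set K) : set K :=
  least [set X | is_cardinal X /\ covered_by C X].

End CSequences.

Definition chi_kappa d (K : orderType d) : set K :=
  if `[< weakly_compact K >] then set0
  else least [set X | is_cardinal X /\
                      forall C : K -> set K, C_sequence C -> chi C `<=` X].

Definition spec d (K : orderType d) : set (set K) :=
  [set X | exists C : K -> set K, C_sequence C /\ X = chi C]
    `&` [set X | infinite_set X].

Arguments chi_kappa {d} K.
Arguments spec {d} K.

(* The intersection is really attained. *)
Lemma least_mem d (K : orderType d) (S : set (set K)) :
    well_order (<=%O : rel K) -> S !=set0 -> S `<=` is_ordinal ->
  S (least S).
Proof.
move=> woK [A0 SA0] Sord; apply: contrapT => nS.
have sub B : S B -> exists x, B x /\ ~ least S x.
  move=> SB; apply: contrapT => h; apply: nS.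
  suff -> : least S = B by [].
  apply/seteqP; split=> [x|x Bx]; first exact.
  by apply: contrapT => nx; apply: h; exists x.
pose N := [pred x : K | `[< ~ least S x >]].
have [x [_ nx]] := sub _ SA0.
have [|m [[/asboolP Nm mlb] _]] := woK N; first by exists x; apply/asboolP.
apply: Nm => B SB; have [y [By nly]] := sub _ SB.
have := mlb y (asboolT nly).
by rewrite le_eqVlt => /orP[/eqP->//|my]; apply: (Sord _ SB y By).
Qed.

(* Main.v *)
(* A C-sequence with finite chi has chi at most 1: if n sets are needed to cover
   Delta `&` below a, and no n - 1 sets suffice on a tail, then each of the n
   sets is unbounded in every a of a cofinal set E, hence contains a by
   closedness, and one of them alone covers E.  So chi_kappa > 1 forces some
   chi C, and therefore chi_kappa, to be infinite.

   If the supremum chi_kappa were not attained, pick for each i < chi_kappa a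
   C-sequence F i with i < chi (F i).  Their diagonal intersection C, taken at
   each b along a club of b of order type cof b, satisfies
   |C b \ F i b| <= |i| for all infinite i; so a cover by sets C b becomes,
   after adding chi C * |i| many sets, a cover by sets F i b.  Hence
   i < chi (F i) <= max (chi C, |i|) for all i < chi_kappa, so that
   chi C = chi_kappa after all. *)
Require Import Defs.
From HB Require Import structures.
From mathcomp Require Import all_boot all_order.
From mathcomp Require Import all_classical.
From mathcomp Require Import wochoice.

Set Implicit Arguments.
Unset Strict Implicit.
Unset Printing Implicit Defensive.

Import Order.TTheory.
Local Open Scope classical_set_scope.
Local Open Scope card_scope.
Local Open Scope order_scope.

(** * Comparing cardinalities through injections *)

Lemma card_le_inj T U (A : set T) (B : set U) (f : T -> U) :
  (forall x, A x -> B (f x)) ->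
  (forall x y, A x -> A y -> f x = f y -> x = y) -> A #<= B.
Proof.
move=> fAB finj; have injA : {in A &, injective f}.
  by move=> x y; rewrite !inE; apply: finj.
have := inj_card_eq injA; rewrite card_eqPle => -[_ /card_le_trans]; apply.
by apply: subset_card_le => _ [x Ax <-]; apply: fAB.
Qed.

Lemma card_le_ex T U (u0 : U) (A : set T) (B : set U) : A #<= B ->
  exists f : T -> U, (forall x, A x -> B (f x)) /\
    (forall x y, A x -> A y -> f x = f y -> x = y).
Proof.
pose U' : pointedType := HB.pack U (gen_eqMixin U) (gen_choiceMixin U)
  (isPointed.Build U u0).
move=> /(@pcard_leP T U')[f]; exists f; split=> [x Ax|x y Ax Ay].
  exact: (@funS _ _ _ _ f).
by apply: (@inj _ _ _ f); rewrite inE.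
Qed.

(* Greedy recursion along [R] assigns to each point a value not used before. *)
Lemma wf_card_le T U (R : T -> T -> Prop) (A : set T) (Y : set U) :
  well_founded R -> (forall p q, [\/ R p q, p = q | R q p]) ->
  (forall p, A p -> card_lt [set q | R q p] Y) -> A #<= Y.
Proof.
move=> wfR triR AY; have [[y0 _]|Y0] := pselect (Y !=set0); last first.
  have -> : A = set0.
    rewrite -subset0 => p /AY; apply.
    by have [->|/set0P//] := eqVneq Y set0.
  exact: card_ge0.
pose step p (F : forall q, R q p -> U) : U :=
  if pselect (exists y, Y y /\ forall q (h : R q p), F q h <> y) is left h
  then projT1 (cid h) else y0.
pose F := Fix wfR (fun=> U) step.
have FE p : F p = step p (fun q _ => F q).
  rewrite /F Fix_eq// => x f g fg; congr step.
  by apply: functional_extensionality_dep => y; apply: functional_extensionality_dep.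
have FP p : A p -> Y (F p) /\ forall q, R q p -> F q <> F p.
  move=> Ap; rewrite FE /step; case: pselect => [h|nh].
    by case: (cid h) => y /= [Yy hy]; split.
  exfalso; apply: (AY p Ap).
  have : Y `<=` F @` [set q | R q p].
    move=> y Yy; apply: contrapT => ny; apply: nh; exists y; split=> // q Rqp Fq.
    by apply: ny; exists q.
  by move=> /subset_card_le /card_le_trans; apply; apply: card_image_le.
apply: (@card_le_inj _ _ _ _ F) => [p /FP[]//|p q Ap Aq Fpq].
have [Rpq|//|Rqp] := triR p q.
  by have [_ /(_ _ Rpq)] := FP _ Aq.
by have [_ /(_ _ Rqp)] := FP _ Ap; rewrite Fpq.
Qed.

(** Hilbert's hotel: along an injected copy [f] of the naturals, [x] goes to [f 0] and [f n] to
    [f n.+1]; other points stay. *)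
Lemma infinite_setU1_le T (A : set T) (x : T) :
  infinite_set A -> x |` A #<= A.
Proof.
move=> infA; have [Ax|nAx] := pselect (A x).
  by apply: subset_card_le => y [->|].
have [f [fA finj]] := card_le_ex x (iffLR (infiniteP A) infA).
have f_inj m n : f m = f n -> m = n by apply: finj.
have /choice[g gP] y : exists z, [\/ y = x /\ z = f 0%N,
    exists2 n, y = f n & z = f n.+1 | [/\ y <> x, forall n, f n <> y & z = y]].
  have [yx|yx] := pselect (y = x); first by exists (f 0%N); constructor 1.
  have [[n ynf]|nf] := pselect (exists n, f n = y).
    by exists (f n.+1); constructor 2; exists n.
  by exists y; constructor 3; split=> // n fy; apply: nf; exists n.
apply: (@card_le_inj _ _ _ _ g) => [y|y z].
  by case: (gP y) => [[_ ->]|[n _ ->]|[yx _ ->] []] //; move=> *; exact: fA.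
case: (gP y) => [[-> ->] _|[n -> ->] _|[yx ny ->] _];
  case: (gP z) => [[-> ->] _|[m -> ->] _|[zx nz ->] _] //.
- by move=> /f_inj.
- by move=> /nz.
- by move=> /f_inj.
- by move=> /f_inj [->].
- by move=> /nz.
- by move=> /esym /ny.
- by move=> /esym /ny.
Qed.

(** * Cardinal arithmetic below an infinite ordinal *)

Section WellOrdered.
Context {d : Order.disp_t} {K : orderType d}.
Hypothesis woK : well_order (<=%O : rel K).
Implicit Types (a b i j : K).

Lemma ex_least (A : set K) : A !=set0 -> exists2 m, A m & forall x, A x -> m <= x.
Proof.
move=> [a Aa]; have [|m [[/asboolP Am mlb] _]] := woK (A := [pred x | `[< A x >]]).
  by exists a; apply/asboolP.
by exists m => // x Ax; apply: mlb; apply/asboolP.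
Qed.

Lemma lt_wf : well_founded (fun x y : K => x < y).
Proof.
move=> a; apply: contrapT => na.
have [|m nm mle] := ex_least (A := [set x | ~ Acc (fun x y : K => x < y) x]).
  by exists a.
apply: nm; constructor => y ym; apply: contrapT => ny.
by have := mle y ny; rewrite leNgt ym.
Qed.

(* Goedel's well-order of the square, under which the predecessors of [p] lie in
   the square of [max p.1 p.2 + 1]. *)
Definition goedel_lt (q p : K * K) : Prop :=
  let m r := Order.max r.1 r.2 in
  m q < m p \/ m q = m p /\ (q.1 < p.1 \/ q.1 = p.1 /\ q.2 < p.2).

Lemma goedel_lt_wf : well_founded goedel_lt.
Proof.
suff H m a b : Order.max a b = m -> Acc goedel_lt (a, b).
  by move=> [a b]; apply: (H _ a b erefl).
elim/(well_founded_ind lt_wf): m a b => m IHm.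
elim/(well_founded_ind lt_wf) => a IHa.
elim/(well_founded_ind lt_wf) => b IHb abm.
constructor=> -[c e] [|[/= cem [ca|[cE eb]]]].
- by rewrite /= abm => /IHm; apply.
- by apply: IHa => //; rewrite cem.
- by rewrite cE in cem *; apply: IHb => //; rewrite cem.
Qed.

Lemma goedel_lt_total p q : [\/ goedel_lt p q, p = q | goedel_lt q p].
Proof.
case: p q => [a b] [c e]; rewrite /goedel_lt /=.
have [h|h|h] := ltgtP (Order.max a b) (Order.max c e).
- by constructor 1; left.
- by constructor 3; left.
have [h1|h1|h1] := ltgtP a c.
- by constructor 1; right; split=> //; left.
- by constructor 3; right; split=> //; left.
have [h2|h2|h2] := ltgtP b e.
- by constructor 1; right; split=> //; right.
- by constructor 3; right; split=> //; right.
- by constructor 2; rewrite h1 h2.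
Qed.

Lemma card_leX T T' U U' (A : set T) (A' : set T') (B : set U) (B' : set U') :
  A #<= B -> A' #<= B' -> A `*` A' #<= B `*` B'.
Proof.
move=> AB AB'; have [[u0 _]|B0] := pselect (B !=set0); last first.
  move: AB; rewrite (_ : B = set0); last by apply/eqP/negPn/negP => /set0P.
  by rewrite card_le0 => /eqP ->; rewrite set0X; exact: card_ge0.
have [[u0' _]|B0'] := pselect (B' !=set0); last first.
  move: AB'; rewrite (_ : B' = set0); last by apply/eqP/negPn/negP => /set0P.
  by rewrite card_le0 => /eqP ->; rewrite setX0; exact: card_ge0.
have [f [fAB finj]] := card_le_ex u0 AB.
have [g [gAB ginj]] := card_le_ex u0' AB'.
apply: (@card_le_inj _ _ _ _ (fun p => (f p.1, g p.2))).
  by move=> [x y] [/fAB ? /gAB ?].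
by move=> [x y] [z t] /= [? ?] [? ?] [/finj -> // /ginj ->].
Qed.

(** Hessenberg's theorem. If [i] is equinumerous with a smaller ordinal, induction applies.
    Otherwise each Goedel segment lies in the square of [m + 1] for some [m < i], and so is smaller
    than [i]. *)
Lemma card_le_square i : infinite_set (below i) ->
  below i `*` below i #<= below i.
Proof.
elim/(well_founded_ind lt_wf): i => i IH infi.
have [[j ji ij]|initial] := pselect (exists2 j, j < i & below i #<= below j).
  have infj : infinite_set (below j) by move=> /(card_le_finite ij).
  apply: card_le_trans (card_leX ij ij) _.
  apply: card_le_trans (IH j ji infj) _.
  by apply: subset_card_le => x /= /lt_trans; apply.
apply: (wf_card_le goedel_lt_wf goedel_lt_total) => -[a b] [/= ai bi].
set m := Order.max a b.
have mi : m < i by rewrite /m gt_max; apply/andP.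
pose M := m |` below m.
have sub : [set q | goedel_lt q (a, b)] `<=` M `*` M.
  move=> [c e] h; have : Order.max c e <= m.
    by case: h => [/ltW|[-> _]].
  by rewrite ge_max !le_eqVlt => /andP[/orP[/eqP|] ? /orP[/eqP|] ?];
    split; rewrite /M /=; (try by left); right.
move=> /card_le_trans/(_ (subset_card_le sub)) iM.
have [finm|infm] := pselect (finite_set (below m)).
  apply: infi; apply: card_le_finite iM _.
  by apply: finite_setX; rewrite /M finite_setU; split.
apply: initial; exists m => //; apply: card_le_trans iM _.
apply: card_le_trans (IH m mi infm).
by apply: card_leX; exact: infinite_setU1_le.
Qed.

(** A point is coded by the index of a set containing it and its position in that set, hence by an
    element of the square. *)
Lemma card_le_bigcup I T i (B : set I) (G : I -> set T) :
  infinite_set (below i) -> B #<= below i ->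
  (forall x, B x -> G x #<= below i) -> \bigcup_(x in B) G x #<= below i.
Proof.
move=> infi Bi Gi; have [h [hB hinj]] := card_le_ex i Bi.
have /choice[g gP] x : exists g : T -> K, B x ->
    (forall y, G x y -> below i (g y)) /\
    (forall y z, G x y -> G x z -> g y = g z -> y = z).
  have [Bx|nBx] := pselect (B x); last by exists (fun=> i).
  by have [g gP] := card_le_ex i (Gi x Bx); exists g.
apply: card_le_trans (card_le_square infi).
have [[[x0 y0] _]|N] := pselect (exists p : I * T, B p.1 /\ G p.1 p.2); last first.
  rewrite (_ : \bigcup_(x in B) G x = set0); first exact: card_ge0.
  by rewrite -subset0 => y [x Bx Gxy]; apply: N; exists (x, y).
have /choice[c cP] y : exists x, (\bigcup_(x in B) G x) y -> B x /\ G x y.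
  have [[x Bx Gxy]|N] := pselect ((\bigcup_(x in B) G x) y); first by exists x.
  by exists x0.
apply: (@card_le_inj _ _ _ _ (fun y => (h (c y), g (c y) y))).
  by move=> y /cP[Bc Gc]; split; [exact: hB|exact: (gP _ Bc).1].
move=> y z /cP[By Gy] /cP[Bz Gz] [hyz gyz].
have hc := hinj _ _ By Bz hyz; rewrite -hc in Gz gyz.
exact: (gP _ By).2 gyz.
Qed.

Lemma card_leU T i (A B : set T) :
  infinite_set (below i) -> A #<= below i -> B #<= below i ->
  A `|` B #<= below i.
Proof.
move=> infi Ai Bi.
rewrite (_ : (A `|` B)%classic = \bigcup_(b in [set: bool]) if b then A else B).
  apply: card_le_bigcup => // [|[]//].
  exact: card_le_trans (countableP _) (iffLR (infiniteP _) infi).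
apply/seteqP; split=> [x [?|?]|x [[] _ ?]]; try by [left|right].
- by exists true.
- by exists false.
Qed.

(** * C-sequences at a single point, and diagonal intersections *)

Definition C_sequence_at (b : K) (c : set K) : Prop :=
  [/\ c `<=` below b, closed_in b c & supremums c = supremums (below b)].

Definition limit_at (b : K) : Prop :=
  below b !=set0 /\ forall x, x < b -> exists2 y, x < y & y < b.

Lemma supremums_belowP (D : set K) a :
  supremums (D `&` below a) a <->
  (forall x, x < a -> exists y, [/\ D y, x < y & y < a]).
Proof.
split=> [[_ lb] x xa|h].
  apply: contrapT => ny; have : a <= x.
    apply: lb => y [Dy ya]; rewrite leNgt; apply/negP => xy.
    by apply: ny; exists y.
  by rewrite leNgt xa.
split=> [y [_ /ltW]//|u uub]; rewrite leNgt; apply/negP => /h[y [Dy uy ya]].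
by have := uub y (conj Dy ya); rewrite leNgt uy.
Qed.

Lemma supremums_eq (A B : set K) x :
  supremums A x -> supremums B x -> supremums A = supremums B.
Proof.
move=> Ax Bx; apply/seteqP; split=> y Cy.
  by rewrite (is_subset1_supremums Cy Ax).
by rewrite (is_subset1_supremums Cy Bx).
Qed.

Lemma C_sequence_at_limitP b c : limit_at b ->
  C_sequence_at b c <->
  [/\ c `<=` below b, closed_in b c & forall x, x < b -> exists2 y, c y & x < y].
Proof.
move=> [_ limb]; have supb : supremums (below b) b.
  rewrite -[below b]setTI; apply/supremums_belowP => x /limb[y xy yb].
  by exists y.
split=> -[cb ccl h]; split=> //.
  have : supremums (c `&` below b) b by rewrite (setIidl cb) h.
  by move=> /supremums_belowP cb' x /cb'[y [cy xy _]]; exists y.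
apply: supremums_eq supb; rewrite -(setIidl cb); apply/supremums_belowP.
by move=> x /h[y cy xy]; exists y; split=> //; apply: cb.
Qed.

(** If [g] were missing, [c] would lie below [g] with supremum [g], and closedness would put [g] in
    [c]. *)
Lemma C_sequence_at_succ b c g : C_sequence_at b c ->
  g < b -> (forall y, y < b -> y <= g) -> below g !=set0 -> c g.
Proof.
move=> [cb ccl csup] gb gmax g0; apply: contrapT => ncg.
have cg : c `<=` below g.
  move=> y cy; rewrite /below /= lt_neqAle gmax ?andbT; last exact: cb.
  by apply/eqP => yg; apply: ncg; rewrite -yg.
have : supremums (below b) g by split=> [y /gmax//|u]; apply.
by rewrite -csup -(setIidl cg) => /ccl h; apply: ncg; apply: h.
Qed.

Section Jumps.
Context {d' : Order.disp_t} {W : orderType d'} (r : K -> W) (b : K).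
Hypothesis rmono : forall x y, y < b -> x <= y -> r x <= r y.
Hypothesis runb : forall x, x < b -> exists2 y, y < b & r x < r y.

(** The first points of the level sets of [r]: a club of [b] on which [r] is injective. *)
Definition jumps : set K := [set g | g < b /\ forall x, x < g -> r x < r g].

Lemma jumps_closed : closed_in b jumps.
Proof.
move=> a ab a0 /supremums_belowP h; split=> // x /h[y [[yb yj] xy ya]].
by apply: lt_le_trans (yj x xy) _; apply: rmono => //; exact: ltW.
Qed.

Lemma jumps_cofinal x : x < b -> exists2 y, jumps y & x < y.
Proof.
move=> xb; have [y0 y0b xy0] := runb xb.
have [|y [yb xy] ymin] := ex_least (A := [set y | y < b /\ r x < r y]).
  by exists y0.
exists y.
  split=> // z zy; apply: le_lt_trans xy; rewrite leNgt; apply/negP => xz.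
  by have := ymin z (conj (lt_trans zy yb) xz); rewrite leNgt zy.
rewrite ltNge; apply/negP => yx.
by have := rmono xb yx; rewrite leNgt xy.
Qed.

Lemma jumps_inj x y : jumps x -> jumps y -> r x = r y -> x = y.
Proof.
move=> [_ xj] [_ yj] rxy; have [/yj|/xj|//] := ltgtP x y.
  by rewrite rxy ltxx.
by rewrite rxy ltxx.
Qed.

End Jumps.

(** Taking for [r x] the least [e] in [M] with [x <= f e] turns a cofinal map into a monotone
    unbounded rank, even when [f] is not monotone. *)
Lemma ex_rank d' (W : orderType d') (f : W -> K) (M : set W) b :
  (forall A : set W, A !=set0 -> exists2 m, A m & forall x, A x -> m <= x) ->
  limit_at b -> (forall e, M e -> f e < b) ->
  (forall x, x < b -> exists2 e, M e & x <= f e) ->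
  exists r : K -> W, [/\ forall x, x < b -> M (r x),
    forall x y, y < b -> x <= y -> r x <= r y &
    forall x, x < b -> exists2 y, y < b & r x < r y].
Proof.
move=> woW [[b0 b0b] limb] Mb fb.
have /choice[r rP] x : exists e, x < b ->
    [/\ M e, x <= f e & forall e', M e' -> x <= f e' -> e <= e'].
  have [xb|xb] := pselect (x < b); last by have [e _ _] := fb _ b0b; exists e.
  have [e Me xe] := fb x xb.
  have [|m [Mm xm] mle] := woW [set e | M e /\ x <= f e]; first by exists e.
  by exists m => _; split=> // e' Me' xe'; apply: mle.
have rmono x y : y < b -> x <= y -> r x <= r y.
  move=> yb xy; have [My yr _] := rP y yb.
  by have [_ _] := rP x (le_lt_trans xy yb); apply => //; apply: le_trans yr.
exists r; split=> // [x /rP[]//|x xb].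
have [Mx xr _] := rP x xb; have [y rxy yb] := limb _ (Mb _ Mx).
exists y => //; have [_ yr _] := rP y yb.
rewrite lt_neqAle rmono ?andbT//; last exact: le_trans xr (ltW rxy).
by apply/eqP => rE; move: rxy; rewrite rE ltNge yr.
Qed.

(* The diagonal intersection of the [F i] along a club of [b] of order type
   the cofinality of [b]: the part missed by [F i] is bounded, hence small. *)
Lemma ex_diagonal (F : K -> set K) b : (forall i, C_sequence_at b (F i)) ->
  exists c, C_sequence_at b c /\
    forall i, infinite_set (below i) -> c `\` F i #<= below i.
Proof.
move=> FC; have card_le1 (A : set K) i : infinite_set (below i) ->
    is_subset1 A -> A #<= below i.
  move=> /infinite_setN0[j ji] A1.
  by apply: (@card_le_inj _ _ _ _ (fun=> j)) => // x y Ax Ay _; apply: A1.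
(* For [b] zero or a successor, [c] is empty or the singleton of the last predecessor. *)
have [limb|nlimb] := pselect (limit_at b); last first.
  have c1 : is_subset1 [set g | g < b /\ forall y, y < b -> y <= g].
    by move=> x y [xb xm] [yb ym]; apply/eqP; rewrite eq_le ym// xm.
  exists [set g | g < b /\ forall y, y < b -> y <= g]; split; last first.
    by move=> i /card_le1; apply => x y [/c1 xy _] [/xy].
  split=> [x []//|a ab [x xa] /supremums_belowP/(_ x xa)[y [[_ /(_ a ab)]]]|].
    by move=> ay _; rewrite ltNge ay.
  have [[x xb xmax]|nmax] := pselect (exists2 x, x < b & forall y, y < b -> y <= x).
    apply: (@supremums_eq _ _ x); split=> [y|u uub].
    - by move=> [/xmax].
    - exact: uub.
    - exact: xmax.
    - exact: uub.
  congr supremums; apply/seteqP; split=> [x []//|x xb].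
  exfalso; apply: nlimb; split; first by exists x.
  move=> y yb; apply: contrapT => h; apply: nmax; exists y => // z zb.
  by rewrite leNgt; apply/negP => yz; apply: h; exists z.
have [[b0 b0b] nextb] := limb.
(* In countable cofinality a club of type omega works: it is countable, so no larger than any
   infinite [below i]. *)
have [[f [fb fcof]]|unct] := pselect (exists f : nat -> K,
    (forall n, f n < b) /\ forall x, x < b -> exists n, x <= f n).
  have wo_nat (A : set nat) : A !=set0 ->
      exists2 m, A m & forall x, A x -> (m <= x)%O.
    move=> [n An]; have h : exists n, `[< A n >] by exists n; apply/asboolP.
    case: (ex_minnP h) => m /asboolP Am mle; exists m => // x Ax.
    by rewrite leEnat; apply: mle; apply/asboolP.
  have [|x xb|r [_ rmono runb]] := @ex_rank _ _ f setT b wo_nat limb.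
  - by move=> e _.
  - by have [n] := fcof x xb; exists n.
  exists (jumps r b); split.
    apply/C_sequence_at_limitP => //; split=> [x []//||x].
      exact: jumps_closed.
    exact: jumps_cofinal.
  move=> i infi; apply: card_le_trans (iffLR (infiniteP _) infi).
  apply: (@card_le_inj _ _ _ _ r) => // x y [jx _] [jy _].
  exact: jumps_inj jx jy.
(* [mu] is the cofinality of [b]; its minimality yields [bounded]. *)
have [|mu [f [fb fcof]] mumin] := ex_least (A := [set mu | exists f : K -> K,
    (forall e, e < mu -> f e < b) /\
    forall x, x < b -> exists2 e, e < mu & x <= f e]).
  by exists b; exists id; split=> // x xb; exists x.
have [r [rmu rmono runb]] := ex_rank ex_least limb fb fcof.
have bounded e g : e < mu -> (forall x, x < e -> g x < b) ->
    exists2 y, y < b & forall x, x < e -> g x < y.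
  move=> emu gb; apply: contrapT => nb; suff : mu <= e by rewrite leNgt emu.
  apply: mumin; exists g; split=> // x xb; apply: contrapT => h; apply: nb.
  exists x => // y ye; rewrite ltNge; apply/negP => xgy.
  by apply: h; exists y.
(* Diagonal intersection: a jump [g] must lie in every [F i] whose index is at most the rank of some
   point before [g]. *)
pose c := [set g | jumps r b g /\ forall x, x < g -> forall i, i <= r x -> F i g].
have cF g x i : c g -> x < g -> i <= r x -> F i g.
  by move=> [_ h] xg; apply: h.
(* One closing-off step: fewer than [mu] indices satisfy [i <= r x], so a single [y] bounds a jump
   and a point of each such [F i], all taken past [x]. *)
have step x : x < b -> exists y, [/\ x < y, y < b,
    exists z, [/\ jumps r b z, x < z & z <= y] &
    forall i, i <= r x -> exists w, [/\ F i w, x < w & w <= y]].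
  move=> xb; have [z jz xz] := jumps_cofinal rmono runb xb.
  have [zb /(_ _ xz) rxz] := jz.
  have /choice[h hP] i : exists w, F i w /\ x < w.
    have /(C_sequence_at_limitP _ limb)[_ _ /(_ x xb)[w]] := FC i.
    by exists w.
  have [i _|y yb yP] := bounded (r z) h (rmu z zb).
    by have [+ _ _] := FC i; apply; have [] := hP i.
  exists (Order.max y z); split.
  - by rewrite lt_max xz orbT.
  - by rewrite gt_max yb zb.
  - by exists z; rewrite le_max lexx orbT.
  - move=> i ix; have [Fh xh] := hP i; exists (h i); split=> //.
    by rewrite le_max ltW// yP//; apply: le_lt_trans rxz.
exists c; split; last first.
  move=> i infi.
  (* Points of rank below [i] inject into [below i] by [r]. Among those of rank at least [i], only
     the first can miss [F i], since it forces all later points of [c] into [F i]. *)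
  have sub : c `\` F i `<=` [set g | c g /\ r g < i] `|`
      [set g | (c g /\ ~ F i g) /\ i <= r g].
    by move=> g cFg; have [rg|ig] := ltP (r g) i; [left; case: cFg|right].
  apply: card_le_trans (subset_card_le sub) _; apply: card_leU => //.
    apply: (@card_le_inj _ _ _ _ r) => [x []//|x y [[jx _] _] [[jy _] _]].
    exact: jumps_inj jx jy.
  apply: card_le1 => // x y [[cx nx] ix] [[cy ny] iy].
  have [xy|yx|//] := ltgtP x y; exfalso.
    by apply: ny; apply: cF xy ix.
  by apply: nx; apply: cF yx iy.
apply/C_sequence_at_limitP => //; split=> [x [[]]//|a ab a0 /supremums_belowP h|].
  split.
    apply: jumps_closed => //; apply/supremums_belowP => x /h[y [[jy _] xy ya]].
    by exists y.
  move=> x xa i ix; have [_ + _] := FC i; apply => //.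
  apply/supremums_belowP => z za.
  have [|y [cy + ya]] := h (Order.max x z); first by rewrite gt_max xa.
  rewrite gt_max => /andP[xy zy]; exists y; split=> //; exact: cF xy ix.
move=> x0 x0b.
have /choice[s sP] x : exists y, x < b -> [/\ x < y, y < b,
    exists z, [/\ jumps r b z, x < z & z <= y] &
    forall i, i <= r x -> exists w, [/\ F i w, x < w & w <= y]].
  by have [/step[y yP]|nx] := pselect (x < b); [exists y|exists x].
(* The supremum [a] of omega many closing-off steps is below [b], whose cofinality is uncountable
   here, and is a limit of every set that membership in [c] requires. *)
pose u n := iter n s x0.
have ub n : u n < b by elim: n => // n IH; have [] := sP _ IH.
have [x1 x1b ux1] : exists2 x, x < b & forall n, u n < x.
  apply: contrapT => h; apply: unct; exists u; split=> // x xb.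
  apply: contrapT => hx; apply: h; exists x => // n.
  by rewrite ltNge; apply/negP => xu; apply: hx; exists n.
have [|a ua amin] := ex_least (A := [set x | forall n, u n < x]).
  by exists x1.
have ab : a < b by apply: le_lt_trans x1b; apply: amin.
have a0 : below a !=set0 by exists x0; apply: (ua 0%N).
have ucof z : z < a -> exists n, z <= u n.
  move=> za; apply: contrapT => h; have : a <= z.
    apply: amin => n; rewrite ltNge; apply/negP => zu.
    by apply: h; exists n.
  by rewrite leNgt za.
have umono m n : (m <= n)%N -> u m <= u n.
  move=> /subnK <-; elim: (n - m)%N => // k IH.
  by apply: le_trans IH _; rewrite addSn; have [/ltW] := sP _ (ub (k + m)%N).
exists a; last exact: (ua 0%N).
split.
  apply: jumps_closed => //; apply/supremums_belowP => x /ucof[n xu].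
  have [_ _ [z [jz uz zs]] _] := sP _ (ub n).
  exists z; split=> //; first exact: le_lt_trans uz.
  exact: le_lt_trans zs (ua n.+1).
move=> x /ucof[n xu] i ix; have [_ + _] := FC i; apply => //.
apply/supremums_belowP => z /ucof[m zu].
(* From stage [n] on the index [i] is handled; from stage [m] on the new point exceeds [z]. *)
have [_ _ _ /(_ i)] := sP _ (ub (maxn n m)).
case=> [|w [Fw uw ws]].
  by apply: le_trans ix _; apply: rmono => //; apply: le_trans xu (umono _ _ (leq_maxl _ _)).
exists w; split=> //.
  by apply: le_lt_trans uw; apply: le_trans zu (umono _ _ (leq_maxr _ _)).
exact: le_lt_trans ws (ua (maxn n m).+1).
Qed.

End WellOrdered.

(** The point with value [n], if any, takes over the value [f x] freed by removing [x]. *)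
Lemma card_le_setD1 T (B : set T) n x :
  B x -> B #<= `I_n.+1 -> B `\ x #<= `I_n.
Proof.
move=> Bx /(card_le_ex 0%N)[f [fB finj]].
apply: (@card_le_inj _ _ _ _ (fun y => if f y == n then f x else f y)).
  move=> y [By yx]; have fxy : f x != f y.
    by apply/eqP => /finj -/(_ Bx By) /esym.
  have := fB _ Bx; have := fB _ By; rewrite /= !ltnS.
  case: eqP => [<- _|/eqP fyn]; first by rewrite leq_eqVlt (negbTE fxy).
  by rewrite leq_eqVlt (negbTE fyn).
move=> y z [By yx] [Bz zx]; case: eqP => fy; case: eqP => fz.
- by move=> _; apply: finj => //; rewrite fy.
- by move=> /(finj _ _ Bx Bz) /esym.
- by move=> /(finj _ _ By Bx).
- exact: finj.
Qed.

(** * Covers of C-sequences over a regular uncountable cardinal *)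

Section RegularUncountable.
Context {d : Order.disp_t} {K : orderType d}.
Hypothesis regK : regular_uncountable_cardinal K.
Implicit Types (C : K -> set K) (X : set K).

Let woK : well_order (<=%O : rel K). Proof. by case: regK. Qed.

(** A bounded set lies in an initial segment, which is too small since [K] is a cardinal; the
    converse is regularity. *)
Lemma cofinalP (A : set K) : A #= [set: K] <-> cofinal A.
Proof.
case: regK => _ [_ cardK] _ reg; split=> [AK a|/reg nA]; last first.
  by rewrite card_eqPle card_leT; split=> //; apply: contrapT.
apply: contrapT => na; apply: (cardK a) => //.
move: AK; rewrite card_eqPle => -[_ /card_le_trans]; apply.
apply: subset_card_le => x Ax; rewrite /below /= ltNge; apply/negP => ax.
by apply: na; exists x.
Qed.

Lemma sequence_bounded (u : nat -> K) : exists x, forall n, u n < x.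
Proof.
case: (regK) => _ _ unc reg; apply: contrapT => h.
have /reg : cofinal (range u).
  move=> a; apply: contrapT => na; apply: h; exists a => n.
  by rewrite ltNge; apply/negP => au; apply: na; exists (u n) => //; exists n.
apply=> Ku; apply: unc; apply: card_le_trans Ku _.
exact: card_image_le.
Qed.

Lemma no_max (a : K) : exists b, a < b.
Proof. by have [b /(_ 0%N)] := sequence_bounded (fun=> a); exists b. Qed.

Lemma ex_point : exists k : K, True.
Proof.
have [_ _ unc _] := regK; apply: contrapT => h; apply: unc.
suff -> : [set: K] = set0 by exact: card_ge0.
by rewrite -subset0 => x _; apply: h; exists x.
Qed.

(** The successor of [x] serves as [y]. *)
Lemma C_sequence_cover C x : C_sequence C -> below x !=set0 -> exists y, C y x.
Proof.
move=> CC x0; have [|y xy ymin] := ex_least woK (A := [set y | x < y]).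
  exact: no_max.
exists y; apply: (C_sequence_at_succ (CC y)) => // z zy.
by rewrite leNgt; apply/negP => /ymin; rewrite leNgt zy.
Qed.

(** Zero is discarded because closedness never forces it into any [C y]. *)
Lemma cofinal_gt0 (A : set K) : cofinal A -> cofinal (A `&` [set x | below x !=set0]).
Proof.
move=> cofA a; have [b ab] := no_max a; have [x Ax bx] := cofA b.
have ax := lt_le_trans ab bx.
by exists x; [split=> //; exists a|exact: ltW].
Qed.

Lemma chi_mem C : C_sequence C -> is_cardinal (chi C) /\ covered_by C (chi C).
Proof.
move=> CC; apply: (least_mem (S := [set X | is_cardinal X /\ covered_by C X]) woK).
  exists setT; split; first by case: regK.
  exists [set x | below x !=set0], (fun=> setT); split=> // [|a x [x0 _]].
    by apply/cofinalP; rewrite -[[set _ | _]]setTI; apply: cofinal_gt0 => a; exists a.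
  by have [y Cyx] := C_sequence_cover CC x0; exists y.
by move=> X [[]].
Qed.

Lemma chi_sub C X : is_cardinal X -> covered_by C X -> chi C `<=` X.
Proof. by move=> cX CX; apply: bigcap_inf. Qed.

(* For the minimal number [n] of covering sets, every [x] in the cover of
   [Delta `&` below a], with [a] in the club [E], has [C x] unbounded in every
   element of [E] up to [a]; so a single [C x] covers [E `&` below a]. *)
Lemma covered_by_finite C X k :
  C_sequence C -> covered_by C X -> finite_set X -> covered_by C [set k].
Proof.
move=> CC [D0 [b0 [/cofinalP D0cof b0X D0b]]] [n0 Xn0].
pose Q n := exists2 D : set K, cofinal D & forall a, exists2 B : set K,
  B #<= `I_n & D `&` below a `<=` \bigcup_(x in B) C x.
have exQ : exists n, `[< Q n >].
  exists n0; apply/asboolP; exists D0 => // a; exists (b0 a) => //.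
  have := card_eq_trans (b0X a) Xn0.
  by rewrite card_eqPle => -[].
case: (ex_minnP exQ) => -[|m] /asboolP[D Dcof DB] nmin.
  exfalso; have [x Dx _] := Dcof k; have [y xy] := no_max x.
  have [B] := DB y; rewrite II0 card_le0 => /eqP -> /(_ x (conj Dx xy)).
  by case.
pose P e a := exists2 B : set K, B #<= `I_m &
  D `&` [set x | e <= x < a] `<=` \bigcup_(x in B) C x.
(* By minimality of [m.+1]: if [m] sets covered every piece of [D] from [e] on, that tail would
   witness [Q m]. *)
have /choice[g gP] e : exists a, e < a /\ ~ P e a.
  apply: contrapT => h; suff /nmin : `[< Q m >] by rewrite ltnn.
  apply/asboolP; exists (D `&` [set x | e <= x]) => [a|a].
    by have [x Dx] := Dcof (Order.max a e); rewrite ge_max => /andP[]; exists x.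
  have [a' ea'] := no_max (Order.max a e).
  have /contrapT[B Bm BP] : ~ ~ P e a'.
    move=> nP; apply: h; exists a'; split=> //.
    by apply: le_lt_trans ea'; rewrite le_max lexx orbT.
  exists B => // x [[Dx ex] xa]; apply: BP; split=> //=.
  by rewrite ex; apply: lt_trans xa _; apply: le_lt_trans ea'; rewrite le_max lexx.
pose E := [set a | limit_at a /\ forall e, e < a -> ~ P e a].
have Ecof : cofinal E.
  move=> a0; pose u n := iter n g a0.
  have us n : u n < u n.+1 by have [] := gP (u n).
  have [x0 ux0] := sequence_bounded u.
  have [|a ua amin] := ex_least woK (A := [set x | forall n, u n < x]).
    by exists x0.
  have ucof z : z < a -> exists n, z <= u n.
    move=> za; apply: contrapT => h; have : a <= z.
      apply: amin => n; rewrite ltNge; apply/negP => zu.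
      by apply: h; exists n.
    by rewrite leNgt za.
  exists a; last exact: ltW (ua 0%N).
  split; first split; first by exists a0; exact: (ua 0%N).
    by move=> z /ucof[n zu]; exists (u n.+1) => //; apply: le_lt_trans zu _.
  move=> e /ucof[n eu] [B Bm BP]; have [_] := gP (u n); apply.
  exists B => // x [Dx /andP[ux xu]]; apply: BP; split=> //=.
  by rewrite (le_trans eu ux)/=; apply: lt_trans xu (ua n.+1).
(* Were [C x] bounded in [a] by some [e < a], the other [m] sets would cover [D] between [e] and
   [a], contrary to [a] being in [E]. *)
have key a B x : E a -> B #<= `I_m.+1 ->
    D `&` below a `<=` \bigcup_(x in B) C x -> B x ->
    forall z, z < a -> exists y, [/\ C x y, z < y & y < a].
  move=> [[_ lima] aP] Bm BP Bx z za; have [e ze ea] := lima z za.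
  apply: contrapT => h; apply: (aP e ea); exists (B `\ x).
    exact: card_le_setD1.
  move=> y [Dy /andP[ey ya]]; have [t Bt Cty] := BP y (conj Dy ya).
  exists t => //; split=> // tx; apply: h; exists y; split=> //.
    by rewrite -tx.
  exact: lt_le_trans ey.
have /choice[b bP] a : exists x, E `&` below a `<=` C x.
  have [a' Ea' aa'] := Ecof a; have [B Bm BP] := DB a'.
  have [[x Bx]|B0] := pselect (B !=set0); last first.
    have [[[z za'] lima'] /(_ z za')] := Ea'; case.
    exists set0; first exact: card_ge0.
    move=> y [Dy /andP[_ ya']]; have [t Bt] := BP y (conj Dy ya').
    by case: B0; exists t.
  exists x => y [Ey ya]; have [_ xcl _] := CC x; have ya' := lt_le_trans ya aa'.
  have [y0 _] := Ey.1; apply: xcl => //.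
    (* Closedness of [C x] applies only below [x]; unboundedness of [C x] in [a'] gives [y < x]. *)
    have [t [Ct yt _]] := key _ _ _ Ea' Bm BP Bx _ ya'.
    by apply: lt_trans yt _; have [+ _ _] := CC x; apply.
  apply/supremums_belowP; apply: key Ey Bm _ Bx.
  by move=> t [Dt ty]; apply: BP; split=> //; apply: lt_trans ya'.
exists E, (fun a => [set b a]); split=> [||a y Ey].
- exact/cofinalP.
- by move=> a; rewrite card_eqPle; split; apply: (@card_le_inj _ _ _ _ (fun=> _)) => // y z -> ->.
- by exists (b a) => //; apply: bP.
Qed.

Lemma ex_cardinal (i : K) :
  exists2 y, y <= i & is_cardinal (below y) /\ below y #= below i.
Proof.
have [|y iy ymin] := ex_least woK (A := [set y | below i #<= below y]).
  by exists i => /=; rewrite card_lexx.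
have yi : y <= i by apply: ymin => /=; rewrite card_lexx.
exists y => //; split; last first.
  by rewrite card_eqPle; split=> //; apply: subset_card_le => x /lt_le_trans; apply.
split=> [a ay x /= xa|a ay ya]; first exact: lt_trans xa ay.
by have := ymin a (card_le_trans iy ya); rewrite leNgt ay.
Qed.

(** Here [k] is zero, so [[set k]] is the ordinal 1. *)
Lemma is_cardinal1 (k : K) : (forall x, k <= x) -> is_cardinal [set k].
Proof.
move=> kmin; have k0 : below k = set0.
  by rewrite -subset0 => x; rewrite /below /= ltNge kmin.
split=> a ->; rewrite k0; first by move=> x [].
by rewrite /card_lt card_le0 => /eqP /seteqP[/(_ k) + _]; apply.
Qed.

(** Each point lost in passing from [C] to [C'] is covered by one extra set [C' (next x)]; this adds
    at most [i] indices for each of at most [i] sets. *)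
Lemma covered_by_diff C C' X i :
  C_sequence C' -> covered_by C X -> infinite_set (below i) -> X #<= below i ->
  (forall b, C b `\` C' b #<= below i) ->
  exists2 y, y <= i & is_cardinal (below y) /\ covered_by C' (below y).
Proof.
move=> CC' [D [b [/cofinalP Dcof bX Db]]] infi Xi CC'i.
have [y yi [cy yiE]] := ex_cardinal i; exists y => //; split=> //.
have /choice[next nextP] x : exists z, below x !=set0 -> C' z x.
  have [/(C_sequence_cover CC')[z]|] := pselect (below x !=set0); first by exists z.
  by exists x.
exists (D `&` [set x | below x !=set0]),
  (* The summand [below y] brings the size up to exactly that of [y]. *)
  (fun a => b a `|` (\bigcup_(x in b a) next @` (C x `\` C' x)) `|` below y).
split=> [|a|a x [[Dx x0] xa]].
- exact/cofinalP/cofinal_gt0.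
- rewrite card_eqPle; split; last by apply: subset_card_le => x; right.
  move: yiE; rewrite card_eqPle => -[yi' iy]; apply: card_le_trans iy.
  have bi : b a #<= below i.
    by have := bX a; rewrite card_eqPle => -[/card_le_trans + _]; apply.
  apply: card_leU => //; apply: card_leU => //.
  apply: card_le_bigcup => // x _; apply: card_le_trans (CC'i x).
  exact: card_image_le.
have [z bz Czx] := Db a x (conj Dx xa).
have [C'zx|nC'zx] := pselect (C' z x); first by exists z => //; left; left.
exists (next x); last exact: nextP.
by left; right; exists z => //; exists x.
Qed.

(** * The supremum [chi_kappa] and its attainment *)

Lemma chi_kappaP : card_lt `I_1 (chi_kappa K) ->
  [/\ is_cardinal (chi_kappa K),
      forall C, C_sequence C -> chi C `<=` chi_kappa K &
      forall X, is_cardinal X -> (forall C, C_sequence C -> chi C `<=` X) ->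
        chi_kappa K `<=` X].
Proof.
(* In the weakly compact case the value is empty, contradicting that it exceeds 1. *)
rewrite /chi_kappa; case: asboolP => [_ []|_ _]; first exact: card_ge0.
set S := [set X | _].
have [|//|cS chiS] := least_mem (S := S) woK.
- by exists setT; split=> //; case: regK.
- by move=> X [[]].
by split=> // X cX chiX; apply: bigcap_inf.
Qed.

Lemma ex_chi_infinite : card_lt `I_1 (chi_kappa K) ->
  exists2 C : K -> set K, C_sequence C & infinite_set (chi C).
Proof.
move=> chi_gt1; have [_ _ chi_min] := chi_kappaP chi_gt1.
apply: contrapT => h; apply: chi_gt1.
have [k0 _] := ex_point.
have [|k _ kmin] := ex_least woK (A := setT); first by exists k0.
have ck : is_cardinal [set k] by apply: is_cardinal1 => x; apply: kmin.
have sub : chi_kappa K `<=` [set k].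
  apply: chi_min => // C CC; apply: chi_sub => //.
  apply: (@covered_by_finite _ (chi C)) => //; first by have [] := chi_mem CC.
  by apply: contrapT => infC; apply: h; exists C.
apply: card_le_trans (subset_card_le sub) _.
by apply: (@card_le_inj _ _ _ _ (fun=> 0%N)) => // x y -> ->.
Qed.

Lemma chi_kappa_attained : card_lt `I_1 (chi_kappa K) ->
  exists2 C : K -> set K, C_sequence C & chi C = chi_kappa K.
Proof.
move=> chi_gt1; have [[chi_ord _] chi_ub chi_min] := chi_kappaP chi_gt1.
have [C0 C0C infC0] := ex_chi_infinite chi_gt1.
apply: contrapT => h.
(* This [j] is infinite, as [chi C0] lies below it; it later raises [i0] to an infinite index
   [i]. *)
have [j chij nC0j] : exists2 j, chi_kappa K j & ~ chi C0 j.
  apply: contrapT => nj; apply: h; exists C0 => //; apply/seteqP; split.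
    exact: chi_ub.
  by move=> j chij; apply: contrapT => nC0j; apply: nj; exists j.
have below_of (C : K -> set K) i : C_sequence C -> ~ chi C i -> chi C `<=` below i.
  move=> CC nCi x Cx; rewrite /below /= ltNge; apply/negP.
  rewrite le_eqVlt => /orP[/eqP ix|ix]; first by apply: nCi; rewrite ix.
  have [[ordC _] _] := chi_mem CC; exact: nCi (ordC _ Cx _ ix).
have infj : infinite_set (below j) by apply: sub_infinite_set (below_of _ _ C0C nC0j) _.
(* The union of all [chi C] is again a cardinal bounding them, so minimality applies; this provides
   each [F i] with [i] in [chi (F i)]. *)
have chi_union : chi_kappa K `<=` \bigcup_(C in @C_sequence d K) @chi d K C.
  apply: chi_min => [|C CC x Cx]; last by exists C.
  split=> [a [C CC Ca] x xa|a [C CC Ca] Ua].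
    by have [[ordC _] _] := chi_mem CC; exists C => //; apply: ordC Ca _ xa.
  have [[_ cardC] _] := chi_mem CC; apply: cardC Ca _.
  by apply: card_le_trans Ua; apply: subset_card_le => x Cx; exists C.
have /choice[F FP] i : exists C : K -> set K, C_sequence C /\ (chi_kappa K i -> chi C i).
  by have [/chi_union[C CC Ci]|ni] := pselect (chi_kappa K i); [exists C|exists C0].
have /choice[C CP] b : exists c, C_sequence_at b c /\
    forall i, infinite_set (below i) -> c `\` F i b #<= below i.
  by apply: (@ex_diagonal _ _ woK (F^~ b)) => i; have [+ _] := FP i; apply.
have CC : C_sequence C by move=> b; have [] := CP b.
apply: h; exists C => //; apply/seteqP; split; first exact: chi_ub.
move=> i0 chii0; pose i := Order.max i0 j.
have chii : chi_kappa K i by rewrite /i; case: leP.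
have [ordC covC] := chi_mem CC.
suff Ci : chi C i.
  have : i0 <= i by rewrite /i le_max lexx.
  rewrite le_eqVlt => /orP[/eqP->//|]; exact: ordC.1 _ Ci _.
(* Otherwise [chi C] lies in [below i], and [F i] is covered at a cardinal [y <= i], contradicting
   [i] in [chi (F i)]. *)
apply: contrapT => nCi.
have infi : infinite_set (below i).
  apply: sub_infinite_set infj => x; rewrite /below /= => xj.
  by rewrite /i lt_max xj orbT.
have [FC /(_ chii) Fi] := FP i.
have [||y yi [cy Fy]] := covered_by_diff FC covC infi.
- exact: subset_card_le (below_of _ _ CC nCi).
- by move=> b; have [_] := CP b; apply.
have := chi_sub cy Fy Fi; rewrite /below /= ltNge.
by rewrite yi.
Qed.

End RegularUncountable.

Theorem theorem4p7 (d : Order.disp_t) (K : orderType d)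
    (regK : regular_uncountable_cardinal K)
    (chi_gt1 : card_lt (`I_1)%classic (chi_kappa K)) :
  is_max (spec K) (chi_kappa K).
Proof.
have [_ chi_ub _] := chi_kappaP regK chi_gt1.
have [C CC chiC] := chi_kappa_attained regK chi_gt1.
have [C0 C0C infC0] := ex_chi_infinite regK chi_gt1.
split=> [|B [[C1 [C1C ->]] _]]; last exact: chi_ub.
split; first by exists C.
exact: sub_infinite_set (chi_ub _ C0C) infC0.
Qed.
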